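(* Let $\alpha\subset M$ be a null Cartan curve with curvatures $\kappa_2\neq0$, $\kappa_3$ on a timelike hypersurface $M^3\subset\mathbb{E}^4_1$ whose unit normal along $\alpha$ is $\eta=\lambda_0T+\mu_0N+\nu_0B_1$ with real constants $\lambda_0,\mu_0,\nu_0$, $\nu_0\neq0$, $\mu_0^2+\nu_0^2=1$, satisfying $$\lambda_0=\nu_0\kappa_2,\qquad \kappa_3r^2+\kappa_2^2r-\kappa_3=0\quad\text{with } r=\mu_0/\nu_0 .$$ Then $\alpha$ is an asymptotic curve of $M$ (i.e. $h(T,T)=0$) if and only if $\kappa_3=0$: within this framework the asymptotic null Cartan curves are precisely the null Cartan cubics.
   Context: Minkowski space-time $\mathbb{E}^4_1$ is $\mathbb{R}^4$ with the metric $\langle x,y\rangle=-x_1y_1+x_2y_2+x_3y_3+x_4y_4$. A null Cartan curve is a smooth null curve $\alpha:I\to\mathbb{E}^4_1$ ($I$ an interval, $\alpha'\neq0$, $\langle\alpha',\alpha'\rangle=0$) parametrized by pseudo-arc length $s$ (so $\langle\alpha'',\alpha''\rangle=1$), together with its Cartan frame $\{T,N,B_1,B_2\}$, $T=\alpha'$, $N=\alpha''$, where $\langle T,T\rangle=\langle B_2,B_2\rangle=0$, $\langle N,N\rangle=\langle B_1,B_1\rangle=1$, $\langle T,B_2\rangle=1$, all other inner products of frame vectors vanish, $\det(T,N,B_1,B_2)=1$, and $$T'=N,\quad N'=\kappa_2B_1-B_2,\quad B_1'=\kappa_3T-\kappa_2N,\quad B_2'=-\kappa_3B_1$$ for smooth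 functions $\kappa_2,\kappa_3:I\to\mathbb{R}$ (the Cartan curvatures). Primes denote $d/ds$. A null Cartan cubic is a null Cartan curve with $\kappa_3\equiv0$. A timelike hypersurface has spacelike unit normal $\eta$, $\langle\eta,\eta\rangle=1$. $h$ is the second fundamental form of $M$ with respect to $\eta$; along $\alpha$, $h(T,X)=-\langle\eta',X\rangle$ for $X$ tangent to $M$. *)

(* Defs.v *)
From HB Require Import structures.
From mathcomp Require Import all_boot all_order all_algebra.
From mathcomp Require Import all_classical all_reals all_analysis.
Set Implicit Arguments.
Unset Strict Implicit.
Unset Printing Implicit Defensive.
Import Order.TTheory GRing.Theory Num.Theory.
Import numFieldNormedType.Exports.
Local Open Scope ring_scope.
Local Open Scope classical_set_scope.

Definition mink (R : realType) (x y : 'rV[R]_4) : R :=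
  - (x 0 0 * y 0 0) + x 0 1 * y 0 1 + x 0 2 * y 0 2 + x 0 3 * y 0 3.

(* C^oo on an open set: every iterated directional derivative, of every order,
   exists and is differentiable. *)
Definition smooth (R : realType) (V W : normedModType R) (U : set V)
    (f : V -> W) : Prop :=
  forall (vs : seq V) (p : V), U p ->
    differentiable (foldr (fun v g => fun x => 'D_v g x) f vs) p.

(* The parameter interval need not be open: a smooth map on I is represented by
   a map that is smooth on an open neighbourhood of I.  As I has nonempty
   interior, the derivatives at points of I, endpoints included, only depend on
   the values on I. *)
Definition smooth_on_interval (R : realType) (W : normedModType R)
    (I : set R) (f : R -> W) : Prop :=
  exists J : set R, [/\ open J, I `<=` J & smooth J f].

Record null_cartan_curve (R : realType) (I : set R) (alpha : R -> 'rV[R]_4)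
    (T N B1 B2 : R -> 'rV[R]_4) (k2 k3 : R -> R) : Prop := NullCartanCurve {
  ncc_interval : is_interval I;
  ncc_interior : I° !=set0;
  ncc_smooth : smooth_on_interval I alpha;
  ncc_smooth_frame : [/\ smooth_on_interval I T, smooth_on_interval I N,
    smooth_on_interval I B1 & smooth_on_interval I B2];
  ncc_smooth_k2 : smooth_on_interval I k2;
  ncc_smooth_k3 : smooth_on_interval I k3;
  ncc_regular : forall s, I s -> derive1 alpha s != 0;
  ncc_null : forall s, I s -> mink (derive1 alpha s) (derive1 alpha s) = 0;
  ncc_pseudo_arc : forall s, I s -> mink (derive1n 2 alpha s) (derive1n 2 alpha s) = 1;
  ncc_T : forall s, I s -> T s = derive1 alpha s;
  ncc_N : forall s, I s -> N s = derive1n 2 alpha s;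
  ncc_TT : forall s, I s -> mink (T s) (T s) = 0;
  ncc_B2B2 : forall s, I s -> mink (B2 s) (B2 s) = 0;
  ncc_NN : forall s, I s -> mink (N s) (N s) = 1;
  ncc_B1B1 : forall s, I s -> mink (B1 s) (B1 s) = 1;
  ncc_TB2 : forall s, I s -> mink (T s) (B2 s) = 1;
  ncc_TN : forall s, I s -> mink (T s) (N s) = 0;
  ncc_TB1 : forall s, I s -> mink (T s) (B1 s) = 0;
  ncc_NB1 : forall s, I s -> mink (N s) (B1 s) = 0;
  ncc_NB2 : forall s, I s -> mink (N s) (B2 s) = 0;
  ncc_B1B2 : forall s, I s -> mink (B1 s) (B2 s) = 0;
  ncc_det : forall s, I s ->
    \det (\matrix_(i < 4) [:: T s; N s; B1 s; B2 s]`_i) = 1;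
  ncc_dT : forall s, I s -> derive1 T s = N s;
  ncc_dN : forall s, I s -> derive1 N s = k2 s *: B1 s - B2 s;
  ncc_dB1 : forall s, I s -> derive1 B1 s = k3 s *: T s - k2 s *: N s;
  ncc_dB2 : forall s, I s -> derive1 B2 s = - (k3 s *: B1 s) }.

Definition null_cartan_cubic (R : realType) (I : set R)
    (alpha : R -> 'rV[R]_4) (T N B1 B2 : R -> 'rV[R]_4) (k2 k3 : R -> R) :
    Prop :=
  null_cartan_curve I alpha T N B1 B2 k2 k3 /\ (forall s, I s -> k3 s = 0).

(* On the open set U, M is the zero set of F, of which 0 is a regular value. *)
Definition defining_function (R : realType) (M U : set 'rV[R]_4)
    (F : 'rV[R]_4 -> R) : Prop :=
  [/\ open U, smooth U F, M `&` U = [set q | U q /\ F q = 0]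
    & forall q, M q -> U q -> exists v, 'D_v F q != 0].

Definition hypersurface (R : realType) (M : set 'rV[R]_4) : Prop :=
  forall p, M p -> exists U F, U p /\ defining_function M U F.

(* T_p M is the kernel of the differential at p of a local defining function;
   it does not depend on that function. *)
Definition tangent (R : realType) (M : set 'rV[R]_4) (p v : 'rV[R]_4) : Prop :=
  exists U F, [/\ U p, defining_function M U F & 'D_v F p = 0].

Definition spacelike_unit_normal (R : realType) (M : set 'rV[R]_4)
    (p n : 'rV[R]_4) : Prop :=
  mink n n = 1 /\ (forall v, tangent M p v -> mink n v = 0).

(* A field on M `&` U is given by a smooth ambient extension to U; only its
   values on M are normal to M. *)
Definition unit_normal_field (R : realType) (M U : set 'rV[R]_4)
    (nu : 'rV[R]_4 -> 'rV[R]_4) : Prop :=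
  [/\ open U, smooth U nu
    & forall q, M q -> U q -> spacelike_unit_normal M q (nu q)].

(* Only local unit normal fields are required: M need not be orientable. *)
Definition timelike_hypersurface (R : realType) (M : set 'rV[R]_4) : Prop :=
  hypersurface M /\
  (forall p, M p -> exists U nu, U p /\ unit_normal_field M U nu).

(* h(X, Y) = - <D_X nu, Y> at p, with respect to the unit normal vector n of M
   at p: nu is any local unit normal field of M with nu(p) = n.  On a timelike
   hypersurface such a field exists, and for X, Y tangent to M at p the value
   depends neither on nu nor on its extension off M. *)
Definition second_fundamental_form (R : realType) (M : set 'rV[R]_4)
    (p n X Y : 'rV[R]_4) : R :=
  xget 0 [set z | exists U nu,
    [/\ U p, unit_normal_field M U nu, nu p = n & z = - mink ('D_X nu p) Y]].

Definition asymptotic_curve (R : realType) (M : set 'rV[R]_4) (I : set R)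
    (alpha eta : R -> 'rV[R]_4) : Prop :=
  forall s, I s ->
    second_fundamental_form M (alpha s) (eta s) (derive1 alpha s) (derive1 alpha s) = 0.

(* Main.v *)
Require Import Defs.
From mathcomp Require Import all_boot all_order all_algebra.
From mathcomp Require Import ring lra.
From mathcomp Require Import all_classical all_reals all_analysis.
Import Order.TTheory GRing.Theory Num.Theory.
Import numFieldNormedType.Exports.
Local Open Scope ring_scope.
Local Open Scope classical_set_scope.

(** Along the curve, $h(T,T) = \mu_0$. Indeed $\langle\eta, T\rangle$ vanishes
    identically, so differentiating it gives
    $h(T,T) = -\langle\eta', T\rangle = \langle\eta, T'\rangle
    = \langle\eta, N\rangle$, and the $N$-component of $\eta$ is the constant
    $\mu_0$. Hence the curve is asymptotic exactly when $\mu_0 = 0$, that is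
    when $r = \mu_0/\nu_0 = 0$. The relation
    $\kappa_3 r^2 + \kappa_2^2 r - \kappa_3 = 0$ reads $\kappa_3 = 0$ when
    $r = 0$, and reads $\kappa_2^2 r = 0$ when $\kappa_3 = 0$; as
    $\kappa_2 \neq 0$, this gives the equivalence.

    The work lies in the identity $h(T,T) = \langle\eta, T'\rangle$
    ([second_fundamental_form_along_curve]), because $h$ is computed with an
    arbitrary local unit normal field $\nu$ of $M$ that is only known to agree
    with $\eta$ at one point of the curve. Two facts about unit normals bridge
    the gap. A tangent space is a hyperplane, so a unit normal is determined up
    to sign ([spacelike_unit_normal_unique]): this makes $\nu$ orthogonal to
    whatever is orthogonal to $\eta$ along the curve, with no need to follow the
    sign of $\nu$ from point to point. And the opposite of a unit normal field
    is again one ([unit_normal_fieldN]), so that some field does take the value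
    $\eta$ at the given point. Since the parameter interval may contain its
    endpoints, the vanishing of $\langle\nu, T\rangle$ may be known on one side
    only; [derive1_eq0_on_interval] shows that this is enough to make its
    derivative zero. *)

Set Implicit Arguments.
Unset Strict Implicit.
Unset Printing Implicit Defensive.

(** * The Minkowski form and its unit normals *)

Lemma minkC (R : realType) (x y : 'rV[R]_4) : mink x y = mink y x.
Proof. by rewrite /mink; ring. Qed.

Lemma minkDl (R : realType) (x y z : 'rV[R]_4) :
  mink (x + y) z = mink x z + mink y z.
Proof. by rewrite /mink !mxE; ring. Qed.

Lemma minkZl (R : realType) (a : R) (x y : 'rV[R]_4) :
  mink (a *: x) y = a * mink x y.
Proof. by rewrite /mink !mxE; ring. Qed.

Lemma minkZr (R : realType) (a : R) (x y : 'rV[R]_4) :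
  mink x (a *: y) = a * mink x y.
Proof. by rewrite minkC minkZl minkC. Qed.

Lemma minkNl (R : realType) (x y : 'rV[R]_4) : mink (- x) y = - mink x y.
Proof. by rewrite -scaleN1r minkZl mulN1r. Qed.

Lemma minkBr (R : realType) (x y z : 'rV[R]_4) :
  mink x (y - z) = mink x y - mink x z.
Proof. by rewrite minkC minkDl minkNl !(minkC _ x). Qed.

Lemma mink_nondegenerate (R : realType) (x : 'rV[R]_4) :
  (forall v, mink x v = 0) -> x = 0.
Proof.
move=> x0.
have [h0 h1 h2 h3] : [/\ x 0 0 = 0, x 0 1 = 0, x 0 2 = 0 & x 0 3 = 0].
  have h i : mink x (delta_mx 0 i) = - (x 0 0 * (i == 0)%:R) + x 0 1 * (i == 1)%:R
      + x 0 2 * (i == 2)%:R + x 0 3 * (i == 3)%:R.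
    by rewrite /mink !mxE !eqxx /= ![_ == i]eq_sym.
  have e i := etrans (esym (h i)) (x0 (delta_mx 0 i)).
  by split; [have := e 0|have := e 1|have := e 2|have := e 3];
    rewrite /= !(mulr1, mulr0, oppr0, addr0, add0r) // => /eqP;
    rewrite oppr_eq0 => /eqP.
apply/rowP => -[[|[|[|[|j]]]] j4] //; rewrite mxE;
  [rewrite -[RHS]h0|rewrite -[RHS]h1|rewrite -[RHS]h2|rewrite -[RHS]h3];
  by congr (x 0 _); apply: val_inj.
Qed.

(** The orthogonal of a hyperplane $\ker L$ is a line: modulo $\ker L$ every
    vector is a multiple of $w$, so the functionals $\langle m,\cdot\rangle$ and
    $\langle n,\cdot\rangle$ are both multiples of $L$, and nondegeneracy makes
    $m$ a multiple $c n$ of $n$. Comparing squares gives $c^2 = 1$. *)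
Lemma unit_normals_of_hyperplane (R : realType) (L : {linear 'rV[R]_4 -> R})
    (w m n : 'rV[R]_4) : L w != 0 ->
  mink m m = 1 -> mink n n = 1 ->
  (forall v, L v = 0 -> mink m v = 0) ->
  (forall v, L v = 0 -> mink n v = 0) -> m = n \/ m = - n.
Proof.
move=> Lw mm nn Lm Ln.
have decomp x : (forall v, L v = 0 -> mink x v = 0) ->
    forall v, mink x v = L v / L w * mink x w.
  move=> Lx v; have : L (v - (L v / L w) *: w) = 0.
    by rewrite linearB linearZ /= [_ *: _]divfK// subrr.
  by move=> /Lx; rewrite minkBr minkZr => /eqP; rewrite subr_eq0 => /eqP.
(* Otherwise n would be orthogonal to every vector, itself included. *)
have nw : mink n w != 0.
  apply/eqP => nw; have := decomp _ Ln n.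
  by rewrite nn nw mulr0 => /eqP; rewrite oner_eq0.
pose c := mink m w / mink n w.
have mE : m = c *: n.
  apply/eqP; rewrite -subr_eq0; apply/eqP/mink_nondegenerate => v.
  rewrite minkC minkBr minkZr !(minkC v) (decomp _ Lm v) (decomp _ Ln v) /c.
  by field; rewrite nw Lw.
have : c ^+ 2 = 1 by rewrite -mm mE minkZl minkZr nn; ring.
move=> /eqP; rewrite sqrf_eq1 => /orP[] /eqP c1; [left|right]; rewrite mE c1.
  by rewrite scale1r.
by rewrite scaleN1r.
Qed.

(** * Opposite of a unit normal field *)

(** Needed because the iterated derivatives of a smooth map are controlled only
    on the open set where the map is smooth, so identities between them are
    merely local. *)
Lemma near_eq_differentiable (R : realType) (V W : normedModType R)
    (f g : V -> W) (x : V) :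
  {near x, f =1 g} -> differentiable f x -> differentiable g x.
Proof.
move=> fg df; have gx : f x = g x := nbhs_singleton fg.
have gE : g \o shift x = cst (g x) + 'd f x +o_ 0 id.
  apply/eqaddoP => e e0.
  have /diff_locally/eqaddoP/(_ _ e0) fE := df.
  have fg0 : \forall y \near 0, f (y + x) = g (y + x).
    by move: fg; rewrite (near_shift 0) subr0.
  near=> y.
  have -> : (g \o shift x - (cst (g x) + 'd f x)) y =
            (f \o shift x - (cst (f x) + 'd f x)) y.
    by rewrite !fctE /= gx (near fg0 y)//.
  by near: y.
have dE : 'd g x = 'd f x :> (V -> W).
  by apply: diff_unique => //; exact: diff_continuous.
by apply/diff_locallyP; rewrite dE; split => //; exact: diff_continuous.
Unshelve. all: by end_near. Qed.

(** Taking a directional derivative commutes with the sign only where the map is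
    derivable, so the identity between iterated derivatives of [- f] and [f] is
    proved on [U] alone, by induction on the list of directions; openness of [U]
    lets each further derivative see that identity on a whole neighbourhood. *)
Lemma smoothN (R : realType) (V W : normedModType R) (U : set V) (f : V -> W) :
  open U -> smooth U f -> smooth U (- f).
Proof.
move=> oU sf.
have NE vs : forall x, U x ->
    foldr (fun v (g : V -> W) => fun x => 'D_v g x) (- f) vs x =
    - foldr (fun v (g : V -> W) => fun x => 'D_v g x) f vs x.
  elim: vs => [//|v vs IH] x Ux /=.
  rewrite -deriveN; last exact/diff_derivable/sf.
  apply: near_eq_derive; have : \forall y \near x, U y by exact: open_nbhs_nbhs.
  by apply: filterS => y /IH.
move=> vs x Ux.
apply: (@near_eq_differentiable _ _ _
  (- foldr (fun v (g : V -> W) => fun x => 'D_v g x) f vs)).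
  have : \forall y \near x, U y by exact: open_nbhs_nbhs.
  by apply: filterS => y /NE.
exact/differentiableN/sf.
Qed.

Lemma spacelike_unit_normalN (R : realType) (M : set 'rV[R]_4)
    (p n : 'rV[R]_4) :
  spacelike_unit_normal M p n -> spacelike_unit_normal M p (- n).
Proof.
move=> [nn nT]; split; first by rewrite minkNl minkC minkNl opprK.
by move=> v /nT; rewrite minkNl => ->; rewrite oppr0.
Qed.

Lemma unit_normal_fieldN (R : realType) (M U : set 'rV[R]_4)
    (nu : 'rV[R]_4 -> 'rV[R]_4) :
  unit_normal_field M U nu -> unit_normal_field M U (- nu).
Proof.
move=> [oU snu nunu]; split => //; first exact: smoothN.
by move=> q Mq Uq; apply: spacelike_unit_normalN; exact: nunu.
Qed.

(** The hyperplane is the kernel of the differential of a local equation of [M];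
    that 0 is a regular value makes this differential nonzero. *)
Lemma spacelike_unit_normal_unique (R : realType) (M : set 'rV[R]_4)
    (p m n : 'rV[R]_4) : hypersurface M -> M p ->
  spacelike_unit_normal M p m -> spacelike_unit_normal M p n ->
  m = n \/ m = - n.
Proof.
move=> hM Mp [mm mT] [nn nT]; have [U [F [Up dF]]] := hM p Mp.
have [oU sF _ /(_ p Mp Up)[w Fw]] := dF.
have Fd : differentiable F p by exact: (sF [::] p Up).
apply: (@unit_normals_of_hyperplane _ ('d F p) w) => //.
- by rewrite -deriveE.
- by move=> v Fv; apply: mT; exists U, F; rewrite deriveE.
- by move=> v Fv; apply: nT; exists U, F; rewrite deriveE.
Qed.

(** * Differentiation along the curve *)

(** At an endpoint, [g] is only known to vanish on one side of [s]. Choosing a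
    second point [y] of the interval and approaching [s] along the segment from [s] to
    [y], the difference quotients of [g] in direction [y - s] are zero, and the
    two-sided derivative must agree with this one-sided limit. *)
Lemma derive1_eq0_on_interval (R : realType) (I : set R) (g : R -> R) (s : R) :
  is_interval I -> I° !=set0 -> I s -> derivable g s 1 ->
  (\forall t \near s, I t -> g t = 0) -> derive1 g s = 0.
Proof.
move=> iI [x0 Ix0] Is dg g0.
have [y Iy ys] : exists2 y, I y & y != s.
  have [x0s|] := eqVneq x0 s; last by exists x0 => //; exact: nbhs_singleton.
  have : \forall y \near x0^', I y /\ y != x0.
    by near=> y; split; [near: y; exact: nbhs_dnbhs | near: y; exact: nbhs_dnbhs_neq].
  move=> near_y; have [y [Iy yx0]] := @filter_ex _ _ (Proper_dnbhs_numFieldType x0) _ near_y.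
  by exists y => //; rewrite -x0s.
have dg' : differentiable g s by apply/derivable1_diffP.
have vdg : 'D_(y - s) g s = (y - s) * derive1 g s.
  by rewrite derive1E !deriveE// -[X in 'd g s X]mulr1 linearZ.
suff : 'D_(y - s) g s = 0.
  by rewrite vdg => /eqP; rewrite mulf_eq0 subr_eq0 (negbTE ys) => /eqP.
rewrite /derive cvg_at_rightE; last exact: diff_derivable.
apply: cvg_lim => //.
apply: (@cvg_trans _ (cst (0 : R) @ (0 : R)^'+)); last exact: cvg_cst.
apply: near_eq_cvg.
have gs : g s = 0 by exact: (nbhs_singleton g0).
have g0' : \forall h \near (0 : R)^'+, I (h * (y - s) + s) -> g (h * (y - s) + s) = 0.
  have seg : h * (y - s) + s @[h --> (0 : R)^'+] --> s.
    rewrite -[X in _ --> X]add0r -[X in X + s](mul0r (y - s)).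
    apply: cvgD; last exact: cvg_cst.
    by apply: cvgMl; apply: cvg_at_right_filter; exact: cvg_id.
  exact: seg g0.
near=> h => /=.
have h0 : 0 < h by [].
have h1 : h < 1 by near: h; exact: nbhs_right_lt.
rewrite gs subr0 (_ : h *: (y - s) = h * (y - s))// (near g0' h)// ?scaler0//.
have [sy|sy] := leP s y.
  by apply: (iI s y) => //; apply/andP; split; nra.
by apply: (iI y s) => //; apply/andP; split; nra.
Unshelve. all: by end_near.
Qed.

Lemma derive1_mink (R : realType) (X Y : R -> 'rV[R]_4) (s : R) :
  derivable X s 1 -> derivable Y s 1 ->
  derivable (fun t => mink (X t) (Y t)) s 1 /\
  derive1 (fun t => mink (X t) (Y t)) s =
    mink (derive1 X s) (Y s) + mink (X s) (derive1 Y s).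
Proof.
have coord (Z : R -> 'rV[R]_4) j : derivable Z s 1 ->
    is_derive s 1 (fun t => Z t 0 j) (derive1 Z s 0 j).
  move=> dZ; rewrite derive1E derive_mx// mxE.
  by apply: derivableP; move: dZ => /derivable_mxP; exact.
move=> dX dY.
have dXj j := coord X j dX; have dYj j := coord Y j dY.
have h : is_derive s 1 (fun t => mink (X t) (Y t))
    (mink (derive1 X s) (Y s) + mink (X s) (derive1 Y s)).
  rewrite /mink.
  apply: is_derive_eq.
  rewrite /GRing.scale /=; ring.
by split; [exact: ex_derive | rewrite derive1E derive_val].
Qed.

(** The Weingarten identity $-\langle D_{\alpha'}\nu, Y\rangle =
    \langle\eta, Y'\rangle$ for $Y$ orthogonal to $\eta$: differentiate
    $\langle\nu\circ\alpha, Y\rangle = 0$. The right-hand side does not involve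
    $\nu$, which shows that the value chosen in the definition of the second
    fundamental form is unambiguous here. *)
Lemma second_fundamental_form_along_curve (R : realType) (M : set 'rV[R]_4)
    (I : set R) (alpha Y eta : R -> 'rV[R]_4) (s : R) :
  timelike_hypersurface M -> is_interval I -> I° !=set0 ->
  (forall t, I t -> M (alpha t)) ->
  (forall t, I t -> spacelike_unit_normal M (alpha t) (eta t)) ->
  (forall t, I t -> mink (eta t) (Y t) = 0) ->
  I s -> derivable alpha s 1 -> derivable Y s 1 ->
  second_fundamental_form M (alpha s) (eta s) (derive1 alpha s) (Y s) =
  mink (eta s) (derive1 Y s).
Proof.
move=> [hypM orientM] iI I0 alphaM eta_normal etaY Is dalpha dY.
have uniq_normal t n : I t -> spacelike_unit_normal M (alpha t) n ->
    n = eta t \/ n = - eta t.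
  move=> It nn; apply: spacelike_unit_normal_unique nn (eta_normal t It) => //.
  exact: alphaM.
have valueE U nu : U (alpha s) -> unit_normal_field M U nu ->
    nu (alpha s) = eta s ->
    - mink ('D_(derive1 alpha s) nu (alpha s)) (Y s) = mink (eta s) (derive1 Y s).
  move=> Us [oU snu nunu] nus.
  have dnu : differentiable nu (alpha s) by exact: (snu [::] (alpha s) Us).
  have dalpha' : differentiable alpha s := (derivable1_diffP _ _).1 dalpha.
  have dnualpha : differentiable (nu \o alpha) s by exact: differentiable_comp.
  have chain : derive1 (nu \o alpha) s = 'D_(derive1 alpha s) nu (alpha s).
    by rewrite derive1E' // diff_comp //= deriveE // derive1E'.
  have dnualpha1 : derivable (nu \o alpha) s 1 by exact: diff_derivable.
  have [dg dgE] := derive1_mink dnualpha1 dY.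
  have nearU : \forall t \near s, U (alpha t).
    apply: (differentiable_continuous dalpha').
    exact: open_nbhs_nbhs.
  (* Nearby, nu (alpha t) is eta t up to a sign that may depend on t; either
     sign keeps it orthogonal to Y t. *)
  have : derive1 (fun t => mink ((nu \o alpha) t) (Y t)) s = 0.
    apply: (derive1_eq0_on_interval iI I0 Is dg).
    apply: filterS nearU => t Ut It /=.
    have [->|->] := uniq_normal t _ It (nunu _ (alphaM t It) Ut).
      exact: etaY.
    by rewrite minkNl etaY ?oppr0.
  rewrite dgE chain /= nus => /eqP; rewrite addrC addr_eq0 => /eqP ->.
  by [].
(* The default value of xget never arises: a normal field through eta s exists,
   after a change of sign if necessary. *)
rewrite /second_fundamental_form; case: xgetP => [z _ [U [nu [Us unu nus ->]]]|].
  exact: (valueE U).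
have [U [nu [Us unu]]] := orientM _ (alphaM s Is).
have [_ _ nunu] := unu.
have [nus|nus] := uniq_normal s _ Is (nunu _ (alphaM s Is) Us).
  by move=> /(_ (- mink ('D_(derive1 alpha s) nu (alpha s)) (Y s)))[]; exists U, nu.
move=> /(_ (- mink ('D_(derive1 alpha s) (- nu) (alpha s)) (Y s)))[].
exists U, (- nu); split => //; first exact: unit_normal_fieldN.
by rewrite fctE nus opprK.
Qed.

Lemma smooth_on_interval_derivable (R : realType) (W : normedModType R)
    (I : set R) (f : R -> W) (s : R) :
  smooth_on_interval I f -> I s -> derivable f s 1.
Proof.
by move=> [J [_ IJ sf]] Is; apply/diff_derivable/(sf [::])/IJ.
Qed.

(** * Asymptotic null Cartan curves *)

Unset Implicit Arguments.

Theorem corollary5 (R : realType) (I : set R) (alpha : R -> 'rV[R]_4)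
    (T N B1 B2 : R -> 'rV[R]_4) (k2 k3 : R -> R)
    (M : set 'rV[R]_4) (eta : R -> 'rV[R]_4) (lambda0 mu0 nu0 : R)
    (hcurve : null_cartan_curve I alpha T N B1 B2 k2 k3)
    (hk2 : forall s, I s -> k2 s != 0)
    (hM : timelike_hypersurface M)
    (halphaM : forall s, I s -> M (alpha s))
    (hnormal : forall s, I s -> spacelike_unit_normal M (alpha s) (eta s))
    (heta : forall s, I s ->
      eta s = lambda0 *: T s + mu0 *: N s + nu0 *: B1 s)
    (hnu0 : nu0 != 0)
    (hunit : mu0 ^+ 2 + nu0 ^+ 2 = 1)
    (hlambda0 : forall s, I s -> lambda0 = nu0 * k2 s)
    (hr : forall s, I s -> let r := mu0 / nu0 in
      k3 s * r ^+ 2 + k2 s ^+ 2 * r - k3 s = 0) :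
  (asymptotic_curve M I alpha eta <-> (forall s, I s -> k3 s = 0)) /\
  (asymptotic_curve M I alpha eta <->
   null_cartan_cubic I alpha T N B1 B2 k2 k3).
Proof.
have hTT s : I s -> second_fundamental_form M (alpha s) (eta s)
    (derive1 alpha s) (derive1 alpha s) = mu0.
  move=> Is; have [sT _ _ _] := ncc_smooth_frame hcurve.
  rewrite -{2}(ncc_T hcurve Is).
  rewrite (second_fundamental_form_along_curve hM (ncc_interval hcurve)
    (ncc_interior hcurve) halphaM hnormal _ Is).
  - rewrite (ncc_dT hcurve Is) heta // !minkDl !minkZl.
    rewrite (ncc_TN hcurve Is) (ncc_NN hcurve Is) minkC (ncc_NB1 hcurve Is).
    by rewrite !mulr0 mulr1 add0r addr0.
  - move=> t It; rewrite heta // !minkDl !minkZl (ncc_TT hcurve It).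
    rewrite (minkC (N t)) (ncc_TN hcurve It) minkC (ncc_TB1 hcurve It).
    by rewrite !mulr0 !addr0.
  - exact: smooth_on_interval_derivable (ncc_smooth hcurve) Is.
  - exact: smooth_on_interval_derivable sT Is.
have asymP : asymptotic_curve M I alpha eta <-> (forall s, I s -> k3 s = 0).
  split=> [asym s Is|k30 s Is].
    have mu00 : mu0 = 0 by rewrite -(hTT s Is); exact: asym.
    move: (hr s Is); rewrite /= mu00 mul0r expr0n /= !mulr0 !add0r.
    by move=> /eqP; rewrite oppr_eq0 => /eqP.
  rewrite hTT //; move: (hr s Is) => /eqP.
  rewrite /= k30 // mul0r add0r subr0 mulf_eq0 expf_eq0 (negbTE (hk2 s Is)).
  by rewrite andbF /= mulf_eq0 invr_eq0 (negbTE hnu0) orbF => /eqP.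
by split=> //; split=> [/asymP|[_ /asymP]].
Qed.
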